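(* (1) For an almost disjoint family $\mathcal{A}$, the Isbell-Mrówka space $\Psi(\mathcal{A})$ is strongly star-Scheepers if and only if $|\mathcal{A}|<\mathfrak{d}$. (2) For a set $Y\subseteq\mathbb{R}$, the Niemytzki plane $N(Y)$ is strongly star-Scheepers if and only if $|Y|<\mathfrak{d}$.
   Context: For $A\subseteq X$ and a family $\mathcal{P}$ of subsets of $X$, $St(A,\mathcal{P})=\bigcup\{B\in\mathcal{P} : A\cap B\neq\emptyset\}$. An $\omega$-cover of $X$ is an open cover $\mathcal{U}$ such that every finite $F\subseteq X$ is contained in some member of $\mathcal{U}$. A space $X$ is strongly star-Scheepers if for each sequence $(\mathcal{U}_n)_{n\in\mathbb{N}}$ of open covers of $X$ there are finite sets $F_n\subseteq X$ such that $\{St(F_n,\mathcal{U}_n) : n\in\mathbb{N}\}$ is an $\omega$-cover of $X$. A family $\mathcal{A}\subseteq P(\mathbb{N})$ is almost disjoint if every $A\in\mathcal{A}$ is infinite and $B\cap C$ is finite for distinct $B,C\in\mathcal{A}$ (maximality is not required). The Isbell-Mrówka space is $\Psi(\mathcal{A})=\mathcal{A}\cup\mathbb{N}$, where points of $\mathbb{N}$ are isolated and basic neighbourhoods of $A\in\mathcal{A}$ are the sets $\{A\}\cup(A\setminus F)$ with $F\subseteq\mathbb{N}$ finite. For $Y\subseteq\mathbb{R}$, the Niemytzki plane is $N(Y)=(Y\times\{0\})\cup(\mathbb{R}\times(0,\infty))$, where $\mathbb{R}\times(0,\infty)$ is open with the Euclidean topology and basic neighbourhoods of $(y,0)$, $y\in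 Y$, are the sets $\{(y,0)\}\cup U$ with $U$ an open disc in $\mathbb{R}\times(0,\infty)$ tangent to the horizontal axis at $(y,0)$. $\mathfrak{d}$ is the minimum cardinality of a dominating subset of $\mathbb{N}^{\mathbb{N}}$, where $D$ is dominating if for every $g\in\mathbb{N}^{\mathbb{N}}$ there is $f\in D$ with $g(n)\leq f(n)$ for all but finitely many $n$. *)

(* Defs.v *)
From HB Require Import structures.
From mathcomp Require Import all_boot all_order all_algebra.
From mathcomp Require Import all_classical all_reals all_analysis.
From mathcomp Require Import ring lra.

Set Implicit Arguments.
Unset Strict Implicit.
Unset Printing Implicit Defensive.

Import Order.TTheory GRing.Theory Num.Theory.
Import numFieldNormedType.Exports.

Local Open Scope classical_set_scope.
Local Open Scope card_scope.
Local Open Scope ring_scope.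

Definition St (X : Type) (A : set X) (P : set (set X)) : set X :=
  \bigcup_(B in P `&` [set B | A `&` B !=set0]) B.

Definition is_open_cover (X : topologicalType) (U : set (set X)) : Prop :=
  U `<=` open /\ \bigcup_(V in U) V = setT.

Definition is_omega_cover (X : topologicalType) (U : set (set X)) : Prop :=
  is_open_cover U /\
  forall F : set X, finite_set F -> exists2 V, U V & F `<=` V.

Definition strongly_star_Scheepers (X : topologicalType) : Prop :=
  forall U : nat -> set (set X), (forall n, is_open_cover (U n)) ->
  exists F : nat -> set X, (forall n, finite_set (F n)) /\
    is_omega_cover [set St (F n) (U n) | n in [set: nat]].

Definition almost_disjoint (A : set (set nat)) : Prop :=
  (forall B, A B -> infinite_set B) /\
  (forall B C, A B -> A C -> B <> C -> finite_set (B `&` C)).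

Definition Psi (A : set (set nat)) : Type := (set_type A + nat)%type.

HB.instance Definition _ A := Choice.copy (Psi A) (set_type A + nat)%type.

Definition Psi_basic (A : set (set nat)) (x : Psi A) (F : set nat)
  : set (Psi A) :=
  match x with
  | inl a => x |` [set inr n | n in set_val a `\` F]
  | inr _ => [set x]
  end.

Definition Psi_nbhs (A : set (set nat)) (x : Psi A) : set_system (Psi A) :=
  [set V | exists2 F : set nat, finite_set F & Psi_basic x F `<=` V].

HB.instance Definition _ A := hasNbhs.Build (Psi A) (@Psi_nbhs A).

Lemma Psi_basicxx A (x : Psi A) F : Psi_basic x F x.
Proof. by case: x => [a|n] //=; left. Qed.

Lemma Psi_nbhs_filter A (x : Psi A) : ProperFilter (nbhs x).
Proof.
split; first by move=> [F _ /(_ x)]; apply; exact: Psi_basicxx.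
split.
- by exists set0.
- move=> V W [F finF FV] [G finG GW]; exists (F `|` G).
    by rewrite finite_setU.
  case: x FV GW => [a|n] /= FV GW y.
    case=> [->|[n [an FGn] <-]].
      by split; [apply: FV; left|apply: GW; left].
    split; [apply: FV|apply: GW]; right; exists n => //; split=> // ?.
      by apply: FGn; left.
    by apply: FGn; right.
  by move=> yn; split; [exact: FV|exact: GW].
- by move=> V W VW [F finF FV]; exists F => //; exact: subset_trans VW.
Qed.

Lemma Psi_nbhs_singleton A (x : Psi A) (V : set (Psi A)) : nbhs x V -> V x.
Proof. by move=> [F _]; apply; exact: Psi_basicxx. Qed.

Lemma Psi_nbhs_nbhs A (x : Psi A) (V : set (Psi A)) :
  nbhs x V -> nbhs x (nbhs^~ V).
Proof.
move=> [F finF FV]; exists F => // y.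
case: x FV => [a|n] /= FV.
  case=> [->|[n an <-]]; first by exists F.
  by exists set0 => //= _ ->; apply: FV; right; exists n.
by move=> ->; exists F.
Qed.

HB.instance Definition _ A := Nbhs_isNbhsTopological.Build (Psi A)
  (@Psi_nbhs_filter A) (@Psi_nbhs_singleton A) (@Psi_nbhs_nbhs A).

Lemma nbhs_PsiE A (x : Psi A) : nbhs x = Psi_nbhs x.
Proof. by []. Qed.

Section niemytzki.
Variable R : realType.
Implicit Type Y : set R.

Definition Niemytzki_set Y : set (R * R) :=
  (Y `*` [set 0]) `|` (setT `*` [set t | 0 < t]).

(* A named copy, so that it does not inherit the subspace topology that
   [set_type] carries by default *)
Definition Niemytzki Y : Type := set_type (Niemytzki_set Y).

HB.instance Definition _ Y :=
  Choice.copy (Niemytzki Y) (set_type (Niemytzki_set Y)).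

Definition Niemytzki_val Y (p : Niemytzki Y) : R * R := set_val p.

(* The open Euclidean disc of centre (y, r) and radius r (the norm of R * R is
   the sup norm, so its balls cannot be used) *)
Definition tangent_disc (y r : R) : set (R * R) :=
  [set q | (q.1 - y) ^+ 2 + (q.2 - r) ^+ 2 < r ^+ 2].

Definition Niemytzki_nbhs Y (p : Niemytzki Y) : set_system (Niemytzki Y) :=
  let v := Niemytzki_val p in
  [set V | if 0 < v.2 then nbhs v (@Niemytzki_val Y @` V)
           else exists2 r : R, 0 < r &
             v |` tangent_disc v.1 r `<=` @Niemytzki_val Y @` V].

HB.instance Definition _ Y := hasNbhs.Build (Niemytzki Y) (@Niemytzki_nbhs Y).

Lemma Niemytzki_val_inj Y : injective (@Niemytzki_val Y).
Proof. exact: val_inj. Qed.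

Lemma image_NiemytzkiE Y (V : set (Niemytzki Y)) (p : Niemytzki Y) :
  (@Niemytzki_val Y @` V) (Niemytzki_val p) -> V p.
Proof. by case=> q Vq /Niemytzki_val_inj <-. Qed.

Lemma open_upper : open [set q : R * R | 0 < q.2].
Proof.
have -> : [set q : R * R | 0 < q.2] = snd @^-1` [set t : R | 0 < t] by [].
by apply: open_comp; [move=> q _; exact: cvg_snd|exact: open_gt].
Qed.

Lemma open_tangent_disc y r : open (tangent_disc y r).
Proof.
pose f (q : R * R) : R :=
  (q.1 - y) * (q.1 - y) + (q.2 - r) * (q.2 - r).
have -> : tangent_disc y r = f @^-1` [set t : R | t < r ^+ 2].
  by apply/seteqP; split=> q; rewrite /tangent_disc /f /= !expr2.
apply: open_comp; last exact: open_lt.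
move=> q _; have c1 : (fun z : R * R => z.1 - y) z @[z --> q] --> q.1 - y.
  by apply: cvgB; [exact: cvg_fst|exact: cvg_cst].
have c2 : (fun z : R * R => z.2 - r) z @[z --> q] --> q.2 - r.
  by apply: cvgB; [exact: cvg_snd|exact: cvg_cst].
by apply: cvgD; apply: cvgM.
Qed.

Lemma tangent_disc_upper y r :
  0 < r -> tangent_disc y r `<=` [set q | 0 < q.2].
Proof.
move=> r0 [a b]; rewrite /tangent_disc /= => h.
have h1 := sqr_ge0 (a - y); have h2 := sqr_ge0 b.
case: (ltP 0 b) => // b0; have h3 : b * r <= 0 by rewrite mulr_le0_ge0 // ltW.
by nra.
Qed.

Lemma tangent_disc_sub y r s :
  0 < r -> r <= s -> tangent_disc y r `<=` tangent_disc y s.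
Proof.
move=> r0 rs [a b] h; have /= b0 := tangent_disc_upper r0 h.
by move: h; rewrite /tangent_disc /=; nra.
Qed.

Lemma upper_val Y q : 0 < q.2 -> exists p : Niemytzki Y, Niemytzki_val p = q.
Proof.
move=> q0; have qY : q \in Niemytzki_set Y.
  by rewrite inE; right.
by exists (exist _ q qY).
Qed.

Lemma Niemytzki_nbhs_filter Y (p : Niemytzki Y) : ProperFilter (nbhs p).
Proof.
have sing V : nbhs p V -> V p.
  rewrite /nbhs /= /Niemytzki_nbhs /=; case: ifP => _.
    by move=> /nbhs_singleton /image_NiemytzkiE.
  by move=> [r _ rV]; apply: image_NiemytzkiE; apply: rV; left.
have imI (V W : set (Niemytzki Y)) : @Niemytzki_val Y @` V `&`
    @Niemytzki_val Y @` W `<=` @Niemytzki_val Y @` (V `&` W).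
  move=> _ [[q Vq <-] [q' Wq' /Niemytzki_val_inj qq']].
  by exists q => //; split => //; rewrite -qq'.
split; first by move/sing.
rewrite /nbhs /= /Niemytzki_nbhs /=; split => /=.
- case: ifPn => p0.
    have : nbhs (Niemytzki_val p) [set q : R * R | 0 < q.2].
      by apply: open_nbhs_nbhs; split => //; exact: open_upper.
    apply: filterS => q q0; have [z <-] := @upper_val Y q q0.
    by exists z.
  exists 1 => // q [->|/(tangent_disc_upper ltr01) q0]; first by exists p.
  by have [z <-] := @upper_val Y q q0; exists z.
- move=> V W /=; case: ifPn => p0.
    by move=> hV hW; exact: filterS (@imI V W) (filterI hV hW).
  move=> [r r0 rV] [s s0 sW]; exists (Num.min r s).
    by rewrite lt_min r0.
  have m0 : 0 < Num.min r s by rewrite lt_min r0.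
  move=> q qm; apply: imI; split; [apply: rV|apply: sW];
    case: qm => [->|qd]; [by left|right|by left|right].
    by apply: tangent_disc_sub qd; rewrite // ge_min lexx.
  by apply: tangent_disc_sub qd; rewrite // ge_min lexx orbT.
- move=> V W VW /=; have sub := @image_subset _ _ (@Niemytzki_val Y) _ _ VW.
  case: ifPn => p0; first exact: filterS.
  by move=> [r r0 rV]; exists r => //; exact: subset_trans sub.
Qed.

Lemma Niemytzki_nbhs_singleton Y (p : Niemytzki Y) (V : set (Niemytzki Y)) :
  nbhs p V -> V p.
Proof.
rewrite /nbhs /= /Niemytzki_nbhs /=; case: ifP => _.
  by move=> /nbhs_singleton /image_NiemytzkiE.
by move=> [r _ rV]; apply: image_NiemytzkiE; apply: rV; left.
Qed.

Lemma Niemytzki_nbhs_nbhs Y (p : Niemytzki Y) (V : set (Niemytzki Y)) :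
  nbhs p V -> nbhs p (nbhs^~ V).
Proof.
have up (z : Niemytzki Y) : 0 < (Niemytzki_val z).2 ->
    nbhs (Niemytzki_val z) (@Niemytzki_val Y @` V) -> nbhs z V.
  by move=> z0 h; rewrite /nbhs /= /Niemytzki_nbhs /= z0.
move=> pV; move: (pV).
change (Niemytzki_nbhs p V -> Niemytzki_nbhs p (nbhs^~ V)).
rewrite /Niemytzki_nbhs /mkset; case: ifPn => p0.
  rewrite {1}nbhsE => -[B [oB Bp] BV].
  rewrite nbhsE; exists (B `&` [set q : R * R | 0 < q.2]).
    by split; [exact: openI oB open_upper|split].
  move=> q [Bq q0]; have [z zq] := @upper_val Y q q0.
  exists z => //; apply: up; rewrite zq //.
  by rewrite nbhsE; exists B.
move=> [r r0 rV]; exists r => // q [->|qd]; first by exists p.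
have q0 := tangent_disc_upper r0 qd.
have [z zq] := @upper_val Y q q0; exists z => //; apply: up; rewrite zq //.
rewrite nbhsE; exists (tangent_disc (Niemytzki_val p).1 r).
  by split => //; exact: open_tangent_disc.
by move=> t td; apply: rV; right.
Qed.

HB.instance Definition _ Y := Nbhs_isNbhsTopological.Build (Niemytzki Y)
  (@Niemytzki_nbhs_filter Y) (@Niemytzki_nbhs_singleton Y)
  (@Niemytzki_nbhs_nbhs Y).

Lemma nbhs_NiemytzkiE Y (p : Niemytzki Y) : nbhs p = Niemytzki_nbhs p.
Proof. by []. Qed.

End niemytzki.

Definition dominating (D : set (nat -> nat)) : Prop :=
  forall g : nat -> nat, exists2 f, D f & \forall n \near \oo, (g n <= f n)%N.

(* The cardinality of D is the dominating number *)
Definition least_dominating (D : set (nat -> nat)) : Prop :=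
  dominating D /\ forall E, dominating E -> D #<= E.

Definition card_lt_dominating_number (T : Type) (A : set T) : Prop :=
  exists2 D, least_dominating D & (A #<= D) /\ ~ (D #<= A).

(* Main.v *)
Require Import Defs.
From mathcomp Require Import all_boot all_order all_algebra.
From mathcomp Require Import all_classical all_reals all_analysis.
From mathcomp Require Import lra.

(* Both spaces X have a countable dense sequence q and are the union of an
   increasing sequence of compact sets K m and of a closed discrete set of
   points e i, i in I, with I = A or Y.

   If |I| < d, let f i n be the first k such that e i lies in the star of q k
   with respect to the n-th cover, and let h m n be such that the star of
   {q 0, ..., q (h m n)} contains K m. Fewer than d functions are obtained by
   taking finite maxima of these, so some g is not dominated by any of them,
   and F n = {q 0, ..., q (g n)} works.

   If |I| >= d, index by I a family F that dominates everywhere; the n-th cover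
   consists of a neighbourhood of each e i, shrinking as F i n grows and
   missing all the other e j, and of the complement of {e i}. Given finite sets
   S n, some F i is large enough for e i to be in the star of no S n.

   Turning strict inequalities between cardinals into these statements needs
   comparability, the existence of least cardinals and, for infinite T,
   |T * T| = |T|, all obtained from Zorn's lemma. *)

Set Implicit Arguments.
Unset Strict Implicit.
Unset Printing Implicit Defensive.

Import Order.TTheory GRing.Theory Num.Theory.
Import numFieldNormedType.Exports.

Local Open Scope classical_set_scope.
Local Open Scope card_scope.

(** * Comparison of cardinals *)

Lemma card_leTTP (T U : Type) :
  [set: T] #<= [set: U] <-> exists f : T -> U, injective f.
Proof.
split=> [/card_leP[f]|[f f_inj]].
  exists (fun x => set_val (f (to_setT x))) => x y /val_inj.
  by move=> /(@inj _ _ _ f) => /(_ (mem_set I) (mem_set I)) [].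
apply/card_leP.
have /Pinj[g ge] : {in [set: set_type [set: T]] &,
    injective (fun x => to_setT (f (set_val x)))}.
  by move=> x y _ _ [/f_inj/val_inj].
by squash (totalfun_ [set: set_type [set: T]] g).
Qed.

(* A maximal set of pairwise everywhere distinct choice functions projects
   onto some [T i]: otherwise a function avoiding all projections extends it. *)
Lemma least_card (I : Type) (T : I -> Type) (i0 : I) :
  exists i, forall j, [set: T i] #<= [set: T j].
Proof.
pose P (S : set (forall i, T i)) :=
  forall s t, S s -> S t -> forall i, s i = t i -> s = t.
have [|S [PS maxS]] := @Zorn_bigcup _ P.
  move=> F FP totF s t [X FX Xs] [Y FY Yt].
  by have [XY|YX] := totF _ _ FX FY; [apply: (FP _ FY) => //; exact: XY|
    apply: (FP _ FX) => //; exact: YX].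
(* If every [x] in [T i] is the value at [i] of some member of [S], sending [x] to the [j]-value of
   that member is injective, since distinct members of [S] differ at [j]. *)
have [[i Si]|noS] := pselect (exists i, forall x, exists s, S s /\ s i = x).
  exists i => j; have [s sP] := choice Si.
  apply/card_leTTP; exists (fun x => s x j) => x y sxy.
  have [Sx <-] := sP x; have [Sy <-] := sP y.
  by rewrite (PS _ _ Sx Sy j sxy).
have avoid i : {x | forall s, S s -> s i <> x}.
  apply: cid; apply: contra_notP noS => Si; exists i => x.
  apply: contrapT => xS; apply: Si; exists x => s Ss sx.
  by apply: xS; exists s.
pose t i := sval (avoid i).
have tP i s : S s -> s i <> t i by apply: (svalP (avoid i)).
have [] := maxS (t |` S).
  split; first by right.
  by move=> /(_ t (or_introl erefl)) St; exact: (tP i0 t St).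
move=> s s' [->|Ss] [->|Ss'] i //.
- by move=> /esym /tP.
- by move=> /tP.
- exact: PS.
Qed.

Lemma card_le_setTT (T U : Type) (A : set T) (B : set U) :
  ([set: A] #<= [set: B]) = (A #<= B).
Proof. by rewrite (card_le_eql (card_setT A)) (card_le_eqr (card_setT B)). Qed.

(** This is [least_card] for a family of two types indexed by [bool]. *)
Lemma card_le_total (T U : Type) (A : set T) (B : set U) :
  A #<= B \/ B #<= A.
Proof.
have [] := least_card (fun b => if b then A : Type else B : Type) true.
case=> leAB; [left; have := leAB false|right; have := leAB true];
  by rewrite /= card_le_setTT.
Qed.

(* Zorn's lemma is applied to the graphs [G] of injections [S * S -> S], where
   [S] is the set of [x] such that [G] is defined at [(x, x)]. Requiring two
   points in every nonempty [S] rules out the maximal graph with [S] a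
   singleton. *)
Lemma card_square_le (T : Type) :
  infinite_set [set: T] -> [set: T * T] #<= [set: T].
Proof.
move=> /infiniteP /card_leTTP[e e_inj].
pose dom (G : set (T * T * T)) := [set x | exists y, G ((x, x), y)].
pose P G := [/\ forall s s' y, G (s, y) -> G (s', y) -> s = s',
  forall s y y', G (s, y) -> G (s, y') -> y = y',
  forall s y, G (s, y) -> [/\ dom G s.1, dom G s.2 & dom G y],
  forall a b, dom G a -> dom G b -> exists y, G ((a, b), y) &
  forall a, dom G a -> dom G (e 0) /\ dom G (e 1)].
have dom_sub G G' : G `<=` G' -> dom G `<=` dom G'.
  by move=> GG' x [y Gy]; exists y; exact: GG'.
have [|G [PG maxG]] := @Zorn_bigcup _ P.
  move=> F FP totF.
  have dir X Y : F X -> F Y -> exists Z, [/\ F Z, X `<=` Z & Y `<=` Z].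
    move=> FX FY; have [XY|YX] := totF _ _ FX FY.
      by exists Y; split.
    by exists X; split.
  have sub X : F X -> X `<=` \bigcup_(X in F) X by move=> FX x Xx; exists X.
  have domU x : dom (\bigcup_(X in F) X) x -> exists2 X, F X & dom X x.
    by move=> [y [X FX Xy]]; exists X => //; exists y.
  split.
  - move=> s s' y [X FX Xs] [Y FY Ys].
    have [Z [FZ XZ YZ]] := dir _ _ FX FY.
    by have [inj _ _ _ _] := FP _ FZ; exact: inj (XZ _ Xs) (YZ _ Ys).
  - move=> s y y' [X FX Xs] [Y FY Ys].
    have [Z [FZ XZ YZ]] := dir _ _ FX FY.
    by have [_ fct _ _ _] := FP _ FZ; exact: fct (XZ _ Xs) (YZ _ Ys).
  - move=> s y [X FX Xs]; have [_ _ sta _ _] := FP _ FX.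
    by have [? ? ?] := sta _ _ Xs; split; apply: (dom_sub _ _ (sub _ FX)).
  - move=> a b /domU[X FX Xa] /domU[Y FY Yb].
    have [Z [FZ XZ YZ]] := dir _ _ FX FY.
    have [_ _ _ tot _] := FP _ FZ.
    have [y Zy] := tot a b (dom_sub _ _ XZ _ Xa) (dom_sub _ _ YZ _ Yb).
    by exists y, Z.
  - move=> a /domU[X FX Xa]; have [_ _ _ _ two] := FP _ FX.
    by have [? ?] := two _ Xa; split; apply: (dom_sub _ _ (sub _ FX)).
have [inj fct sta tot two] := PG.
(* An empty maximal graph is impossible: a pairing on [nat], carried along [e], gives a nonempty
   admissible one. *)
have [S0|/set0P[x0 Sx0]] := eqVneq (dom G) set0.
  have G0 : G `<=` set0.
    by move=> [s y] /sta[]; rewrite S0.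
  have /card_leTTP[p p_inj] : [set: nat * nat] #<= [set: nat].
    exact: countableP.
  pose G' := [set ((e n.1, e n.2), e (p n)) | n in [set: nat * nat]].
  have domG' n : dom G' (e n) by exists (e (p (n, n))), (n, n).
  case: (maxG G').
    split; first by move=> z /G0.
    by move=> /(_ _ (imageP _ (I : setT (0, 0)))) /G0.
  split.
  - move=> s s' y [n _ [<- <-]] [m _ [<-]] /e_inj/p_inj ->.
    by [].
  - by move=> s y y' [[n n'] _ [<- <-]] [[m m'] _ [/e_inj <- /e_inj <- <-]].
  - by move=> s y [n _ [<- <-]] /=; split; exact: domG'.
  - move=> a b [y [n _ [<- _ _]]] [y' [m _ [<- _ _]]].
    by exists (e (p (n.1, m.1))), (n.1, m.1).
  - by move=> a _; split; exact: domG'.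
pose S := dom G; have [Se0 Se1] := two _ Sx0.
have [q qP] : exists q : T * T -> T,
    forall a b, S a -> S b -> G ((a, b), q (a, b)).
  have /choice[q qP] : forall z : T * T, exists y, S z.1 -> S z.2 -> G (z, y).
    move=> [a b]; have [Sa|nSa] := pselect (S a); last by exists x0.
    have [Sb|nSb] := pselect (S b); last by exists x0.
    by have [y Gy] := tot _ _ Sa Sb; exists y.
  by exists q => a b; exact: qP (a, b).
have Sq a b : S a -> S b -> S (q (a, b)).
  by move=> Sa Sb; have [] := sta _ _ (qP _ _ Sa Sb).
have q_inj a b a' b' : S a -> S b -> S a' -> S b' ->
    q (a, b) = q (a', b') -> a = a' /\ b = b'.
  move=> Sa Sb Sa' Sb' qE; have := qP _ _ Sa Sb; rewrite qE => Gq.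
  by have [] := inj _ _ _ Gq (qP _ _ Sa' Sb').
have e01 : e 0 <> e 1 by move=> /e_inj.
(* [d false] and [d true] embed two disjoint copies of [S] into [S]. *)
pose d (b : bool) x := q (e b, x).
have Se (b : bool) : S (e b) by case: b.
have Sd b x : S x -> S (d b x) by move=> Sx; exact: Sq.
have d_inj b b' x x' : S x -> S x' -> d b x = d b' x' -> b = b' /\ x = x'.
  move=> Sx Sx' /(q_inj _ _ _ _ (Se b) Sx (Se b') Sx')[/e_inj].
  by case: b b' => -[].
(* If the complement of [S] injects into [S], the two copies of [S] inside [S] have room for all of
   [T]; then [q] composed with this injection [r] handles [T * T]. *)
have [leS|leSC] := card_le_total (~` S) S.
  have [r rS r_inj] : exists2 r : T -> T, forall x, S (r x) & injective r.
    have /card_leTTP[h h_inj] : [set: set_type (~` S)] #<= [set: set_type S].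
      by rewrite card_le_setTT.
    have hS (x : set_type (~` S)) : S (set_val (h x)) by exact: set_valP.
    have memC x : ~ S x -> x \in ~` S by move=> nSx; rewrite inE.
    exists (fun x => if pselect (S x) is right nSx
      then d true (set_val (h (SigSub (memC x nSx)))) else d false x).
      by move=> x; case: pselect => ?; exact: Sd.
    move=> x y; case: pselect => Sx; case: pselect => Sy.
    - by move=> /d_inj[].
    - by move=> /d_inj[].
    - by move=> /d_inj[].
    - by move=> /d_inj[//|//|_ /val_inj/h_inj[]].
  apply/card_leTTP; exists (fun z => q (r z.1, r z.2)) => -[a b] [a' b'].
  by move=> /q_inj[//|//|//|//| /= /r_inj -> /r_inj ->].
have [i iS i_inj] : exists2 i : T -> T, forall x, S x -> ~ S (i x) &
    forall x y, S x -> S y -> i x = i y -> x = y.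
  have /card_leTTP[h h_inj] : [set: set_type S] #<= [set: set_type (~` S)].
    by rewrite card_le_setTT.
  have hS (x : set_type S) : ~ S (set_val (h x)) by exact: (set_valP (h x)).
  exists (fun x => if pselect (S x) is left Sx
    then set_val (h (SigSub (mem_set Sx))) else x0).
    by move=> x Sx; case: pselect.
  move=> x y Sx Sy; case: pselect => // ?; case: pselect => // ?.
  by move=> /val_inj/h_inj[].
pose S' := S `|` (i @` S).
have [r rS r_inj] : exists2 r : T -> T, forall x, S' x -> S (r x) &
    forall x y, S' x -> S' y -> r x = r y -> x = y.
  have /choice[j jP] : forall y, exists x, (i @` S) y -> S x /\ i x = y.
    move=> y; have [[x Sx xy]|ny] := pselect ((i @` S) y); first by exists x.
    by exists x0.
  exists (fun x => if pselect (S x) then d false x else d true (j x)).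
    move=> x [Sx|iSx]; case: pselect => // nSx; try exact: Sd.
    by apply: Sd; case: (jP _ iSx).
  have jS x : S' x -> ~ S x -> S (j x) /\ i (j x) = x.
    by move=> [Sx /(_ Sx)//|/jP].
  move=> x y S'x S'y; case: pselect => Sx; case: pselect => Sy.
  - by move=> /d_inj[].
  - by have [? _] := jS _ S'y Sy; move=> /d_inj[].
  - by have [? _] := jS _ S'x Sx; move=> /d_inj[].
  - have [Sjx jx] := jS _ S'x Sx; have [Sjy jy] := jS _ S'y Sy.
    by move=> /d_inj[//|//|_ jxy]; rewrite -jx jxy.
pose c z := i (q (r z.1, r z.2)).
pose N := [set z : T * T | [/\ S' z.1, S' z.2 & ~ (S z.1 /\ S z.2)]].
pose G' := G `|` [set (z, c z) | z in N].
have iS' x : S x -> S' (i x) by move=> Sx; right; exists x.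
have cS' z : N z -> S' (c z).
  by move=> [z1 z2 _]; apply: iS'; apply: Sq; exact: rS.
have cnS z : N z -> ~ S (c z).
  by move=> [z1 z2 _]; apply: iS; apply: Sq; exact: rS.
have c_inj z z' : N z -> N z' -> c z = c z' -> z = z'.
  case: z z' => [a b] [a' b'] [/= ? ? _] [/= ? ? _].
  have [] : [/\ S (r a), S (r b), S (r a') & S (r b')] by split; exact: rS.
  move=> Sa Sb Sa' Sb'.
  move=> /(i_inj _ _ (Sq _ _ Sa Sb) (Sq _ _ Sa' Sb')).
  by move=> /(q_inj _ _ _ _ Sa Sb Sa' Sb')[/r_inj -> // /r_inj ->].
have domG' : dom G' = S'.
  apply/seteqP; split=> x.
    move=> [y [Gy|[z [Sx _ _] [zE _]]]]; first by left; exists y.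
    by move: Sx; rewrite zE.
  move=> S'x; have [[y Gy]|nSx] := pselect (S x); first by exists y; left.
  by exists (c (x, x)); right; exists (x, x) => //; split => // -[].
have GS s y : G (s, y) -> [/\ S s.1, S s.2 & S y] by exact: sta.
case: (maxG G').
  split; first by move=> z; left.
  move=> G'G; have : S (i (e 0)); last exact: iS Se0.
  apply: (dom_sub _ _ G'G); rewrite domG'; exact: iS'.
rewrite /P domG'; split.
- move=> s s' y [Gs|[z Nz [<- <-]]] [Gs'|[z' Nz' [<- zz']]].
  + exact: inj Gs Gs'.
  + by have [_ _] := GS _ _ Gs; rewrite -zz' => /(cnS _ Nz').
  + by have [_ _ /(cnS _ Nz)] := GS _ _ Gs'.
  + exact: esym (c_inj _ _ Nz' Nz zz').
- move=> s y y' [Gs|[z Nz [<- <-]]] [Gs'|[z' Nz' [zz' <-]]].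
  + exact: fct Gs Gs'.
  + by have [? ? _] := GS _ _ Gs; case: Nz' => _ _; rewrite zz' => -[].
  + by have [? ? _] := GS _ _ Gs'; case: Nz => _ _ [].
  + by rewrite zz'.
- move=> s y [/GS[? ? ?]|[z Nz [<- <-]]]; first by split; left.
  by have [? ? _] := Nz; split => //; exact: cS'.
- move=> a b S'a S'b; have [[Sa Sb]|nS] := pselect (S a /\ S b).
    by exists (q (a, b)); left; exact: qP.
  by exists (c (a, b)); right; exists (a, b).
- by move=> a _; split; left.
Qed.

(** A list is coded by its length together with the iterated pairing of its entries; the pairing
    alone is only known to be injective on lists of equal length. *)
Lemma card_seq_le (T : Type) :
  infinite_set [set: T] -> [set: seq T] #<= [set: T].
Proof.
move=> T_inf; have /card_leTTP[p p_inj] := card_square_le T_inf.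
have /card_leTTP[e e_inj] := (infiniteP _).1 T_inf.
pose code (s : seq T) := foldr (fun x y => p (x, y)) (e 0) s.
have code_inj s s' : size s = size s' -> code s = code s' -> s = s'.
  elim: s s' => [|x s IHs] [|x' s'] //= [sz] /p_inj[-> ss'].
  by rewrite (IHs _ sz ss').
apply/card_leTTP; exists (fun s => p (e (size s), code s)) => s s'.
by move=> /p_inj[/e_inj]; exact: code_inj.
Qed.

(** * Dominating families *)

(** Diagonal argument: the successor of the maximum at [n] of the functions numbered up to [n] is
    eventually above each numbered function. *)
Lemma dominating_uncountable (D : set (nat -> nat)) :
  dominating D -> ~ countable D.
Proof.
move=> domD; rewrite /countable -(card_le_eql (card_setT D)).
move=> /card_leTTP[h h_inj].
have /choice[u uP] : forall k, exists f, forall d, h d = k -> set_val d = f.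
  move=> k; have [[d hd]|nd] := pselect (exists d, h d = k).
    by exists (set_val d) => d' hd'; congr set_val; apply: h_inj; rewrite hd.
  by exists (fun=> 0) => d hd; case: nd; exists d.
have [f Df [N _ gf]] := domD (fun n => (\max_(k < n.+1) u k n).+1).
(* This [n] is past the threshold [N] and large enough for [f] itself to occur in the maximum. *)
pose d : D := SigSub (mem_set Df); pose n := maxn N (h d).
have := gf n (leq_maxl _ _); rewrite ltnNge => /negP; apply.
have hn : h d < n.+1 by rewrite ltnS leq_maxr.
by have := leq_bigmax (F := fun k : 'I_n.+1 => u k n) (Ordinal hn);
  rewrite /= -(uP _ d erefl).
Qed.

Lemma dominating_infinite (D : set (nat -> nat)) :
  dominating D -> infinite_set D.
Proof. by move=> domD /finite_set_countable /dominating_uncountable; apply. Qed.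

Lemma ex_least_dominating : exists D, least_dominating D.
Proof.
have domT : dominating setT by move=> g; exists g => //; exact: nearW.
have [[D domD] leD] := least_card
  (fun E : {E | dominating E} => set_type (sval E)) (exist _ _ domT).
exists D; split=> // E domE.
have := leD (exist _ E domE).
by rewrite /= card_le_setTT.
Qed.

(** This form avoids choosing a least dominating set; the converse rests on existence of such a set
    and on comparability. *)
Lemma card_lt_dominating_numberP (T : Type) (A : set T) :
  card_lt_dominating_number A <-> forall D, dominating D -> ~ (D #<= A).
Proof.
split=> [[D [_ leD] [_ nDA]] E /leD leDE leEA|nA].
  exact/nDA/(card_le_trans leDE).
have [D [domD leD]] := ex_least_dominating; exists D => //.
by split; [have [|/nA] := @card_le_total _ _ A D|exact: nA].
Qed.

(* A [g] failing for all [s] and [m] would be dominated by the functions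
   [max (max_(i in s) f i) (h m)], and there are too few of them. *)
Lemma small_family_escape (I : choiceType) (f : I -> nat -> nat)
    (h : nat -> nat -> nat) :
  (forall D, dominating D -> ~ (D #<= [set: I])) ->
  exists g : nat -> nat, forall (s : seq I) m,
    exists n, (forall i, i \in s -> f i n <= g n) /\ h m n <= g n.
Proof.
move=> smallI; apply: contrapT => /forallNP noesc.
pose Phi (z : seq I * nat) n := maxn (\max_(i <- z.1) f i n) (h z.2 n).
have domE : dominating (range Phi).
  move=> g; have /existsNP[s /existsNP[m /forallNP nesc]] := noesc g.
  exists (Phi (s, m)); first by exists (s, m).
  apply: nearW => n; rewrite leqNgt gtn_max; apply/negP => /andP[lef leh].
  apply: (nesc n); split; last exact: ltnW.
  by move=> i si; apply/ltnW/(leq_ltn_trans _ lef)/leq_bigmax_seq.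
have leE : range Phi #<= [set: seq I * nat] by exact: card_image_le.
(* For finite [I] the family [Phi] is countable, hence not dominating; for infinite [I] it injects
   into [I], against [smallI]. *)
have [/finite_set_countable/card_leTTP[c c_inj]|infI] :=
    pselect (finite_set [set: I]).
  apply: (dominating_uncountable domE); apply: card_le_trans leE _.
  apply: (@card_le_trans _ (seq nat * nat)%type _ setT); last exact: countableP.
  apply/card_leTTP; exists (fun z => (map c z.1, z.2)) => -[s m] [s' m'].
  by case=> /(inj_map c_inj) -> ->.
apply: (smallI _ domE); apply: card_le_trans leE _.
have /card_leTTP[p p_inj] := card_square_le infI.
have /card_leTTP[q q_inj] := card_seq_le infI.
have /card_leTTP[e e_inj] := (infiniteP _).1 infI.
apply/card_leTTP; exists (fun z => p (q z.1, e z.2)) => -[s m] [s' m'].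
by move=> /p_inj[/q_inj -> /e_inj ->].
Qed.

(** Adding all constants to the members of [D] turns eventual domination into domination everywhere,
    and [D * nat] still injects into [I] because [D] is infinite. *)
Lemma ex_everywhere_dominating (I : Type) (D : set (nat -> nat)) :
  dominating D -> D #<= [set: I] ->
  exists F : I -> nat -> nat, forall g, exists i, forall n, g n <= F i n.
Proof.
move=> domD leDI; have infD := dominating_infinite domD.
have [p p_inj] : exists p : D * nat -> I, injective p.
  apply/card_leTTP; apply: card_le_trans leDI.
  rewrite -(card_le_eqr (card_setT D)).
  have {}infD : infinite_set [set: D].
    by move: infD; rewrite !infiniteP (card_le_eqr (card_setT D)).
  apply: card_le_trans (card_square_le infD).
  have /card_leTTP[e e_inj] := (infiniteP _).1 infD.
  apply/card_leTTP; exists (fun z => (z.1, e z.2)) => -[? ?] [? ?].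
  by case=> -> /e_inj ->.
have /choice[F FP] : forall i, exists f : nat -> nat, forall (d : D) m,
    p (d, m) = i -> f = fun n => set_val d n + m.
  move=> i; have [[[d m] pi]|ni] := pselect (exists z, p z = i).
    by exists (fun n => set_val d n + m) => d' m'; rewrite -pi => /p_inj[-> ->].
  by exists id => d m pi; case: ni; exists (d, m).
exists F => g; have [f Df [N _ gf]] := domD g.
(* The constant [m] takes care of the finitely many arguments below the threshold [N]. *)
pose m := \max_(k < N) g k.
exists (p (SigSub (mem_set Df), m)) => n; rewrite (FP _ _ _ erefl) /=.
have [Nn|nN] := leqP N n; first by rewrite (leq_trans (gf _ Nn)) ?leq_addr.
apply: leq_trans (leq_addl _ _).
exact: (leq_bigmax (F := fun k : 'I_N => g k) (Ordinal nN)).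
Qed.

(** * Criteria for strong star-Scheepersness *)

Section star_Scheepers.
Variable X : topologicalType.

Lemma St_open (A : set X) (U : set (set X)) : U `<=` open -> open (St A U).
Proof. by move=> oU; apply: bigcup_open => B [/oU]. Qed.

Lemma St_subset (A B : set X) (U : set (set X)) :
  A `<=` B -> St A U `<=` St B U.
Proof.
move=> AB x [V [UV [y [Ay Vy]]] Vx].
by exists V => //; split => //; exists y; split => //; exact: AB.
Qed.

Lemma is_omega_cover_range (W : nat -> set X) : (forall n, open (W n)) ->
  (forall F, finite_set F -> exists n, F `<=` W n) ->
  is_omega_cover (range W).
Proof.
move=> oW fin; split; last first.
  by move=> F /fin[n FW]; exists (W n) => //; exists n.
split; first by move=> _ [n _ <-].
apply/seteqP; split=> // x _.
have [n /(_ _ erefl) Wx] := fin [set x] (finite_set1 x).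
by exists (W n) => //; exists n.
Qed.

Lemma small_star_Scheepers (I : choiceType) (q : nat -> X) (e : I -> X)
    (K : nat -> set X) :
  (forall V, open V -> V !=set0 -> exists k, V (q k)) ->
  (forall m n, m <= n -> K m `<=` K n) -> (forall m, compact (K m)) ->
  (forall x, range e x \/ exists m, K m x) ->
  (forall D, dominating D -> ~ (D #<= [set: I])) ->
  strongly_star_Scheepers X.
Proof.
move=> q_dense K_incr K_cpt eK smallI U cU.
have oU n : U n `<=` open by case: (cU n).
have ex_k n x : exists k, forall j, k <= j -> St (q @` `I_j.+1) (U n) x.
  have [V UV Vx] : (\bigcup_(V in U n) V) x by case: (cU n) => _ ->.
  have [k Vqk] := q_dense V (oU _ _ UV) (ex_intro _ _ Vx).
  exists k => j kj; exists V => //; split => //; exists (q k); split => //.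
have ex_K n m : exists k, K m `<=` St (q @` `I_k.+1) (U n).
  (* Compactness is used in its near-covering form: each point has a neighbourhood, namely a star,
     inside the stars of all longer initial segments of [q]. *)
  have /compact_near_coveringP/(_ nat \oo
    (fun k x => St (q @` `I_k.+1) (U n) x) _)[|k _ Kk] := K_cpt m.
    move=> x _; have [k /(_ k (leqnn k)) kx] := ex_k n x.
    exists (St (q @` `I_k.+1) (U n), [set j | k <= j]).
      split; first by apply: open_nbhs_nbhs; split => //; exact: St_open.
      by exists k.
    move=> [y j] /= [+ kj]; apply: St_subset; apply: image_subset => i /=.
    by move=> /leq_trans; apply; rewrite ltnS.
  by exists k; exact: Kk k (leqnn k).
have /choice[f fP] : forall i, exists f, forall n j,
    f n <= j -> St (q @` `I_j.+1) (U n) (e i).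
  by move=> i; have /choice[f fP] := ex_k^~ (e i); exists f.
have /choice[h hP] : forall m, exists h, forall n,
    K m `<=` St (q @` `I_(h n).+1) (U n).
  by move=> m; have /choice[h hP] := ex_K^~ m; exists h.
have [g gP] := small_family_escape f h smallI.
exists (fun n => q @` `I_(g n).+1); split.
  by move=> n; apply: finite_image; exact: finite_II.
apply: is_omega_cover_range; first by move=> n; exact: St_open.
move=> F /finite_seqP[s ->].
(* Since the [K m] increase, a finite set needs only finitely many indices and a single [m]. *)
have [t [m tm]] : exists (t : seq I) m, forall x, x \in s ->
    (exists2 i, i \in t & e i = x) \/ K m x.
  elim: s => [|x s [t [m IHs]]]; first by exists [::], 0.
  have [[i _ eix]|[m' Kx]] := eK x.
    exists (i :: t), m => y; rewrite inE => /predU1P[->|/IHs[[j tj <-]|]].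
    - by left; exists i => //; rewrite mem_head.
    - by left; exists j => //; rewrite inE tj orbT.
    - by right.
  exists t, (maxn m m') => y; rewrite inE => /predU1P[->|/IHs[|Ky]].
  - by right; apply: K_incr Kx; exact: leq_maxr.
  - by left.
  - by right; apply: K_incr Ky; exact: leq_maxl.
have [n [fn hn]] := gP t m; exists n => x /tm[[i ti <-]|Kx].
  by apply: fP; exact: fn.
apply: St_subset (hP m n x Kx); apply: image_subset => j /= /leq_trans; apply.
by rewrite ltnS.
Qed.

(* [c] bounds the [k] for which [x] can lie in some [V i k], so a cover by the
   sets [V i (f i)] with [f] large separates every [e i] from a finite set. *)
Lemma star_Scheepers_small (I : Type) (e : I -> X) (V : I -> nat -> set X)
    (c : X -> nat) :
  (forall i k, open (V i k)) -> (forall i k, V i k (e i)) ->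
  (forall i j k, V i k (e j) -> i = j) ->
  (forall i k x, V i k x -> x <> e i -> k < c x) ->
  open (~` range e) ->
  strongly_star_Scheepers X ->
  forall D, dominating D -> ~ (D #<= [set: I]).
Proof.
move=> oV Ve V_disc Vc oe sssX D domD leDI.
have [F FP] := ex_everywhere_dominating domD leDI.
have e_inj i j : e i = e j -> i = j.
  by move=> eij; apply: (V_disc i j 0); rewrite -eij.
pose U n := ~` range e |` [set V i (F i n) | i in [set: I]].
have [|S [finS [[_ Scover] _]]] := sssX U.
  move=> n; split; first by move=> B [->//|[i _ <-]].
  apply/seteqP; split=> // x _.
  have [[i _ <-]|ex] := pselect (range e x); last first.
    by exists (~` range e) => //; left.
  by exists (V i (F i n)) => //; right; exists i.
have /choice[s sP] : forall n, exists s : seq X, S n = [set` s].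
  by move=> n; exact/finite_seqP.
(* If [x] is [e i], then [w x n] exceeds [F i n]; an [F i] bounding these values on every [S n]
   therefore keeps [e i] out of every [S n]. *)
have /choice[w wP] : forall x, exists w : nat -> nat, forall i, e i = x ->
    w = fun n => (F i n).+1.
  move=> x; have [[i ex]|nx] := pselect (exists i, e i = x).
    by exists (fun n => (F i n).+1) => j; rewrite -ex => /e_inj ->.
  by exists id => i ex; case: nx; exists i.
have [i iP] := FP (fun n => \max_(x <- s n) maxn (c x) (w x n)).
have : (\bigcup_(W in [set St (S n) (U n) | n in [set: nat]]) W) (e i).
  by rewrite Scover.
case=> _ [n _ <-] [B [UB [x [Sx Bx]]] Bi].
have sx : x \in s n by move: Sx; rewrite sP.
have := leq_trans (leq_bigmax_seq (P := xpredT)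
  (F := fun x => maxn (c x) (w x n)) _ sx isT) (iP n).
rewrite geq_max => /andP[cx wx].
(* Among the members of the cover, only the neighbourhood of [e i] itself can contain [e i]. *)
case: UB Bi Bx => [->|[j _ <-]]; first by case; exists i.
move=> /V_disc -> Vx; have [xi|xi] := pselect (x = e i).
  by move: wx; rewrite (wP x i) // ltnn.
by have := Vc _ _ _ Vx xi; rewrite ltnNge cx.
Qed.

End star_Scheepers.

(** * Isbell-Mrowka spaces *)

Section Psi_space.
Variable A : set (set nat).

Lemma open_Psi_basic (x : Psi A) F : finite_set F -> open (Psi_basic x F).
Proof.
move=> finF; rewrite openE => y; rewrite /interior /= nbhs_PsiE.
case: x => [a|n] /=; last by move=> ->; exists set0.
case=> [->|[n an <-]]; first by exists F.
by exists set0 => //= _ ->; right; exists n.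
Qed.

Lemma Psi_inr_dense : (forall B, A B -> infinite_set B) ->
  forall V : set (Psi A), open V -> V !=set0 -> exists k, V (inr k).
Proof.
move=> infA V oV [x Vx].
have : nbhs x V by exact: open_nbhs_nbhs.
rewrite nbhs_PsiE => -[F finF]; case: x {Vx} => [a|n] /= FV; last first.
  by exists n; exact: FV.
have [k [ak Fk]] : (set_val a `\` F) !=set0.
  apply/infinite_setN0/infinite_setD => //.
  by apply: infA; exact: set_valP.
by exists k; apply: FV; right; exists k.
Qed.

Lemma Psi_star_Scheepers : almost_disjoint A ->
  strongly_star_Scheepers (Psi A) <-> card_lt_dominating_number A.
Proof.
move=> [infA _]; rewrite card_lt_dominating_numberP.
split=> [sssA D domD|smallA].
  rewrite -(card_le_eqr (card_setT A)).
  (* The neighbourhood of [a] with the numbers up to [k] removed contains [j] only if [k < j], so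
     [c] can be [j] itself. *)
  apply: (star_Scheepers_small (e := inl : A -> Psi A)
    (V := fun a k => Psi_basic (inl a : Psi A) `I_k.+1)
    (c := fun x => if x is inr j then j else 0)) sssA D domD.
  - by move=> a k; exact/open_Psi_basic/finite_II.
  - by move=> a k; left.
  - by move=> a b k [[->]|[]].
  - move=> a k x [->//|[j [_ /negP]]].
    by rewrite -leqNgt => kj <-.
  - suff -> : ~` range (inl : A -> Psi A) = \bigcup_k Psi_basic (inr k) set0.
      by apply: bigcup_open => k _; exact: open_Psi_basic.
    apply/seteqP; split=> [[a|k] nx|_ [k _ ->] []//].
      by case: nx; exists a.
    by exists k.
(* The compact sets are the finite initial segments of the isolated points. *)
apply: (small_star_Scheepers (X := Psi A) (q := inr) (e := inl : A -> Psi A)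
  (K := fun m => [set (inr k : Psi A) | k in `I_m.+1])).
- exact: Psi_inr_dense.
- by move=> m n mn; apply: image_subset => k /= /leq_trans; apply.
- by move=> m; apply/finite_compact/finite_image/finite_II.
- by move=> [a|k]; [left; exists a|right; exists k, k => /=].
- by move=> D; rewrite (card_le_eqr (card_setT A)); exact: smallA.
Qed.

End Psi_space.

Local Open Scope ring_scope.

(** * Niemytzki planes *)

Section Niemytzki_plane.
Variables (R : realType) (Y : set R).

Lemma nbhs_Niemytzki_upper (p : Niemytzki Y) (V : set (Niemytzki Y)) :
  0 < (Niemytzki_val p).2 ->
  nbhs p V <-> nbhs (Niemytzki_val p) (@Niemytzki_val R Y @` V).
Proof. by move=> p0; rewrite nbhs_NiemytzkiE /Niemytzki_nbhs /= p0. Qed.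

Lemma nbhs_Niemytzki_line (p : Niemytzki Y) (V : set (Niemytzki Y)) :
  (Niemytzki_val p).2 = 0 ->
  nbhs p V <-> exists2 r : R, 0 < r & Niemytzki_val p |`
    tangent_disc (Niemytzki_val p).1 r `<=` @Niemytzki_val R Y @` V.
Proof. by move=> p0; rewrite nbhs_NiemytzkiE /Niemytzki_nbhs /= p0 ltxx. Qed.

Definition line_point (y : Y) : Niemytzki Y :=
  SigSub (mem_set (or_introl (conj (set_valP y) erefl) :
    Niemytzki_set Y (set_val y, 0))).

Lemma line_pointE y : Niemytzki_val (line_point y) = (set_val y, 0).
Proof. by []. Qed.

Lemma NiemytzkiP (p : Niemytzki Y) :
  range line_point p \/ 0 < (Niemytzki_val p).2.
Proof.
have [[Yx p0]|[_ /= p0]] := set_valP p; last by right.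
left; exists (SigSub (mem_set Yx)) => //; apply: Niemytzki_val_inj.
by rewrite line_pointE /= -[0]p0 -surjective_pairing.
Qed.

(** A total section of [Niemytzki_val] over the open half-plane; all other pairs go to a default
    point. *)
Lemma ex_upper : exists up : R * R -> Niemytzki Y,
  forall q, 0 < q.2 -> Niemytzki_val (up q) = q.
Proof.
have [p0 _] := @upper_val R Y (0, 1) ltr01.
have /choice[up upP] : forall q : R * R, exists p : Niemytzki Y,
    0 < q.2 -> Niemytzki_val p = q.
  move=> q; have [q0|] := ltP 0 q.2; last by exists p0.
  by have [p pq] := @upper_val R Y q q0; exists p.
by exists up.
Qed.

Lemma open_nbhs_upper (V : set (Niemytzki Y)) : open V -> V !=set0 ->
  exists q : R * R, 0 < q.2 /\ nbhs q (@Niemytzki_val R Y @` V).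
Proof.
move=> oV [p Vp]; have pV : nbhs p V by exact: open_nbhs_nbhs.
have [[y _ yp]|p0] := NiemytzkiP p; last first.
  by exists (Niemytzki_val p); split => //; exact/nbhs_Niemytzki_upper.
have [|r r0 rV] := (nbhs_Niemytzki_line V _).1 pV; first by rewrite -yp.
(* At a boundary point, the centre of a tangent disc serves as the required upper point. *)
have rr : tangent_disc (Niemytzki_val p).1 r ((Niemytzki_val p).1, r).
  by rewrite /tangent_disc /= !subrr expr0n /= addr0 exprn_gt0.
exists ((Niemytzki_val p).1, r); split => //.
apply: (@filterS _ _ _ (tangent_disc (Niemytzki_val p).1 r)).
  by move=> q qr; apply: rV; right.
by apply: open_nbhs_nbhs; split => //; exact: open_tangent_disc.
Qed.

Lemma nbhs_rat (q : R * R) (O : set (R * R)) :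
  nbhs q O -> exists r : rat * rat, O (ratr r.1, ratr r.2).
Proof.
move=> /nbhs_ballP[eps /= eps0 epsO].
have ex_rat (x : R) : exists r : rat, ball x eps (ratr r).
  have [|r] := @rat_in_itvoo R (x - eps) (x + eps); first by lra.
  rewrite in_itv /= => /andP[r1 r2]; exists r.
  by rewrite /ball /= ltr_norml; lra.
have [a qa] := ex_rat q.1; have [b qb] := ex_rat q.2.
by exists (a, b); apply: epsO.
Qed.

(** This makes Euclidean compact subsets of the open half-plane compact in the Niemytzki plane. *)
Lemma continuous_upper (up : R * R -> Niemytzki Y) :
  (forall q, 0 < q.2 -> Niemytzki_val (up q) = q) ->
  forall q, 0 < q.2 -> {for q, continuous up}.
Proof.
move=> upP q q0 V; rewrite nbhs_simpl /= => Vq.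
have /= : nbhs q (@Niemytzki_val R Y @` V).
  by rewrite -[q]upP //; apply/nbhs_Niemytzki_upper => //; rewrite upP.
have : nbhs q [set q : R * R | 0 < q.2].
  by apply: open_nbhs_nbhs; split => //; exact: open_upper.
apply: filterS2 => z z0 [p Vp pz] /=.
by have <- : p = up z by apply: Niemytzki_val_inj; rewrite upP.
Qed.

Lemma small_Niemytzki_star_Scheepers :
  (forall D, dominating D -> ~ (D #<= Y)) ->
  strongly_star_Scheepers (Niemytzki Y).
Proof.
move=> smallY; have [up upP] := ex_upper.
pose rat_point k := if unpickle k is Some r then (ratr r.1, ratr r.2) : R * R
  else 0.
(* These rectangles exhaust the open half-plane; the lower bound [1/(m+1)] keeps each of them
   strictly above the axis, also for [m = 0]. *)
pose box m : set (R * R) :=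
  `[- m%:R, m%:R]%classic `*` `[m.+1%:R^-1, m%:R]%classic.
have box_upper m q : box m q -> 0 < q.2.
  case=> _ /=; rewrite in_itv /= => /andP[mq _].
  by apply: lt_le_trans mq; rewrite invr_gt0.
apply: (small_star_Scheepers (q := up \o rat_point) (e := line_point)
  (K := fun m => up @` box m)).
- move=> V oV V0; have [q [q0 qV]] := open_nbhs_upper oV V0.
  have : nbhs q [set q : R * R | 0 < q.2].
    by apply: open_nbhs_nbhs; split => //; exact: open_upper.
  move=> /(filterI qV)/nbhs_rat[r [[p Vp pr] r0]].
  exists (pickle r); rewrite /= /rat_point pickleK.
  by rewrite (_ : up _ = p) //; apply: Niemytzki_val_inj; rewrite upP.
- move=> m n mn; apply: image_subset => -[a b] /=; rewrite /box /= !in_itv /=.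
  have mnR : m%:R <= n%:R :> R by rewrite ler_nat.
  have nmR : n.+1%:R^-1 <= m.+1%:R^-1 :> R.
    by rewrite lef_pV2 ?posrE // ler_nat.
  move=> [/andP[? ?] /andP[ma ?]]; split; apply/andP; split; try lra.
  exact: le_trans ma.
- move=> m; apply: continuous_compact.
    apply: continuous_in_subspaceT => q; rewrite inE => /box_upper.
    exact: continuous_upper.
  by apply: compact_setX; exact: segment_compact.
- move=> p; have [|p0] := NiemytzkiP p; first by left.
  right; pose q := Niemytzki_val p.
  (* Bounding the inverse of the height keeps [q] above the lower edge of the box. *)
  pose m := maxn (Num.bound `|q.1|)
    (maxn (Num.bound `|q.2|) (Num.bound q.2^-1)).
  exists m, q; last by apply: Niemytzki_val_inj; rewrite upP.
  have le_m (x : R) (k : nat) : 0 <= x -> (k <= m)%N -> (Num.bound x <= k)%N ->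
      x <= m%:R.
    move=> x0 km xk; apply: ltW; apply: lt_le_trans (archi_boundP x0) _.
    by rewrite ler_nat (leq_trans xk).
  have q1 : `|q.1| <= m%:R by apply: (le_m _ m); rewrite ?leq_maxl.
  have q2 : `|q.2| <= m%:R.
    by apply: (le_m _ m); rewrite // leq_max leq_maxl orbT.
  have qV : q.2^-1 <= m%:R.
    by apply: (le_m _ m); rewrite ?invr_ge0 ?(ltW p0) // !leq_max leqnn !orbT.
  move: q1 q2; rewrite !ler_norml => /andP[? ?] /andP[_ ?].
  split; rewrite /= in_itv /=; apply/andP; split => //.
  rewrite -[q.2]invrK lef_pV2 ?posrE ?invr_gt0 //.
  by rewrite (le_trans qV) // ler_nat.
- by move=> D; rewrite (card_le_eqr (card_setT Y)); exact: smallY.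
Qed.

Lemma Niemytzki_star_Scheepers_small :
  strongly_star_Scheepers (Niemytzki Y) ->
  forall D, dominating D -> ~ (D #<= Y).
Proof.
move=> sssY D domD; rewrite -(card_le_eqr (card_setT Y)).
have r0 (k : nat) : 0 < k.+1%:R^-1 :> R by rewrite invr_gt0.
(* The discs have radius [1/(k+1)], so their points have height [h < 2/(k+1)], that is
   [k + 1 < 2/h]; this is where the bound [c] comes from. *)
pose V (y : Y) k : set (Niemytzki Y) := line_point y |`
  [set p | tangent_disc (set_val y) k.+1%:R^-1 (Niemytzki_val p)].
apply: (star_Scheepers_small (e := line_point) (V := V)
  (c := fun p => Num.bound (2 / (Niemytzki_val p).2))) sssY D domD.
- move=> y k; rewrite openE => p; rewrite /interior /= => -[->|kp].
    apply/nbhs_Niemytzki_line => //; exists k.+1%:R^-1 => // q.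
    case=> [->|kq]; first by exists (line_point y) => //; left.
    have [p' p'q] := @upper_val R Y q (tangent_disc_upper (r0 k) kq).
    by exists p' => //; right; rewrite /= p'q.
  have p0 := tangent_disc_upper (r0 k) kp.
  apply/nbhs_Niemytzki_upper => //.
  apply: (@filterS _ _ _ (tangent_disc (set_val y) k.+1%:R^-1)).
    move=> q kq; have q0 := tangent_disc_upper (r0 k) kq.
    have [p' p'q] := @upper_val R Y q q0.
    by exists p' => //; right; rewrite /= p'q.
  by apply: open_nbhs_nbhs; split => //; exact: open_tangent_disc.
- by move=> y k; left.
- move=> y z k [/(congr1 (@Niemytzki_val R Y))|/(tangent_disc_upper (r0 k))].
    by rewrite !line_pointE => -[/val_inj].
  by rewrite /= ltxx.
- move=> y k p [//|kp] _; have /= p0 := tangent_disc_upper (r0 k) kp.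
  set v := Niemytzki_val p in p0 kp *; rewrite -(ltr_nat R).
  (* A height of at least twice the radius [r] would make the vertical term alone at least
     [r ^+ 2]. *)
  have v2 : v.2 < 2 * k.+1%:R^-1.
    move: kp (r0 k); rewrite /tangent_disc /=; move: (k.+1%:R^-1) => r.
    have := sqr_ge0 (v.1 - set_val y); move: (_ ^+ 2) => x x0 vr rp.
    by rewrite ltNge; apply/negP => ?; nra.
  apply: lt_trans (archi_boundP _); last by rewrite divr_ge0 // ltW.
  rewrite ltr_pdivlMr //; move: v2; rewrite ltr_pdivlMr // => v2.
  apply: le_lt_trans v2; rewrite mulrC ler_wpM2l ?ler_nat //; exact: ltW.
- rewrite openE => p pY; have [//|p0] := NiemytzkiP p.
  apply/nbhs_Niemytzki_upper => //.
  apply: (@filterS _ _ _ [set q : R * R | 0 < q.2]); last first.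
    by apply: open_nbhs_nbhs; split => //; exact: open_upper.
  move=> q q0; have [p' p'q] := @upper_val R Y q q0; exists p' => //.
  by case=> y _ yp'; move: q0; rewrite /= -p'q -yp' ltxx.
Qed.

End Niemytzki_plane.

Theorem corollary3p19 (R : realType) :
  (forall A : set (set nat), almost_disjoint A ->
     (strongly_star_Scheepers (Psi A) <-> card_lt_dominating_number A))
  /\
  (forall Y : set R,
     (strongly_star_Scheepers (Niemytzki Y) <-> card_lt_dominating_number Y)).
Proof.
split=> [A adA|Y]; first exact: Psi_star_Scheepers.
rewrite card_lt_dominating_numberP; split.
  exact: Niemytzki_star_Scheepers_small.
exact: small_Niemytzki_star_Scheepers.
Qed.
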